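(* Let $E(x)=\left(1-\frac1{x^2}\right)^{-1}$ and, for each positive integer $n$, let $$A_n=\begin{pmatrix}\displaystyle\prod_{p\mid 2n+1}E(p) & E(2n+1)\\ E(2n+3)&\displaystyle\prod_{p\mid 2n+3}E(p)\end{pmatrix},$$ where the products are taken over prime divisors $p$, and let $|A_n|$ be the determinant of $A_n$. Let $s>2$ be a real number. Then there is a positive constant $\tau(s)$, depending on $s$, such that the series $$\omega(s)=\sum_{n=1}^{\infty}\frac{1}{1+|A_n|\,n^s}$$ converges if and only if there are finitely many pairs of twin primes, and, if the number of pairs of twin primes is a finite number $N$, then the series converges to $N+\tau(s)$.
   Context: A pair of twin primes is a pair $(p,p+2)$ with both $p$ and $p+2$ prime. *)

(* Defs.v *)
From HB Require Import structures.
From mathcomp Require Import all_boot all_order all_algebra.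
From mathcomp Require Import all_classical all_reals all_analysis.

Set Implicit Arguments.
Unset Strict Implicit.
Unset Printing Implicit Defensive.

Import Order.TTheory GRing.Theory Num.Theory.
Import numFieldNormedType.Exports.

Local Open Scope classical_set_scope.
Local Open Scope ring_scope.

Definition E {R : realType} (x : R) : R := (1 - 1 / x ^+ 2)^-1.

(* [primes m] lists each prime divisor of [m] once, without multiplicity. *)
Definition prodE (R : realType) (m : nat) : R := \prod_(p <- primes m) E p%:R.

Definition A (R : realType) (n : nat) : 'M[R]_2 :=
  \matrix_(i < 2, j < 2)
    match val i, val j with
    | 0%N, 0%N => prodE R (2 * n + 1)%N
    | 0%N, _   => E (2 * n + 1)%N%:R
    | _, 0%N   => E (2 * n + 3)%N%:R
    | _, _     => prodE R (2 * n + 3)%N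
    end.

Definition omega_term (R : realType) (s : R) (n : nat) : R :=
  1 / (1 + \det (A R n) * n%:R `^ s).

Definition omega_psum (R : realType) (s : R) (k : nat) : R :=
  \sum_(1 <= n < k.+1) omega_term s n.

Definition twin_prime_pairs : set (nat * nat) :=
  [set pq | [/\ prime pq.1, prime pq.2 & pq.2 = (pq.1 + 2)%N]].

(* Main.v *)
Require Import Defs.
From HB Require Import structures.
From mathcomp Require Import all_boot all_order all_algebra.
From mathcomp Require Import all_classical all_reals all_analysis.
From mathcomp Require Import finmap zify ring lra.

Set Implicit Arguments.
Unset Strict Implicit.
Unset Printing Implicit Defensive.

Import Order.TTheory GRing.Theory Num.Theory.
Import numFieldNormedType.Exports.

Local Open Scope classical_set_scope.
Local Open Scope ring_scope.

(* With m = 2n+1, every E(p) is at least 1, so |A_n| >= 0, and |A_n| = 0 when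
   (m, m+2) is a twin prime pair: such an n contributes exactly 1 to omega(s).
   Otherwise some q among m, m+2 is composite and has a prime factor p <= sqrt q;
   the surplus E(p) - E(q) >= 1/(q-1) - 1/(q^2-1) = q/(q^2-1) >= 1/(2q) gives
   |A_n| >= 1/(10 n), so the remaining terms are at most 10 n^(-(s-1)), which is
   summable since s - 1 > 1; tau(s) is the sum of these remaining terms. *)

(** * Size of the determinant, for twin and non-twin indices *)

Section Determinant.
Variable R : realType.
Implicit Types (x y : R) (m n p : nat).

Lemma E_sub1 x : 1 < x -> E x = 1 + (x ^+ 2 - 1)^-1.
Proof.
move=> x1; have x2 : 1 < x ^+ 2 by rewrite expr_gt1 // ltW // (lt_trans _ x1).
rewrite /E; field; rewrite !lt0r_neq0 //; first 1 last.
- by rewrite subr_gt0.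
- exact: lt_trans x1.
Qed.

Lemma E_ge1 x : 1 < x -> 1 <= E x.
Proof.
move=> x1; rewrite E_sub1 // lerDl invr_ge0 subr_ge0 ltW //.
by rewrite expr_gt1 // ltW // (lt_trans _ x1).
Qed.

Lemma prodE_prime p : prime p -> prodE R p = E p%:R.
Proof. by move=> pp; rewrite /prodE primes_prime // big_seq1. Qed.

(** Once the factor at [pdiv m] is split off, every remaining factor is at least 1, a property that
    products preserve. *)
Lemma E_pdiv_le_prodE m : (1 < m)%N -> E (pdiv m)%:R <= prodE R m.
Proof.
move=> m1; have pm : pdiv m \in primes m.
  by rewrite mem_primes pdiv_prime // pdiv_dvd ltnW.
rewrite /prodE (bigD1_seq (pdiv m)) ?primes_uniq //= ler_peMr //.
  by rewrite (le_trans ler01) // E_ge1 // ltr1n prime_gt1 // pdiv_prime.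
rewrite big_seq_cond; elim/big_ind: _ => // [x y x1 y1|p].
  by rewrite (le_trans x1) // ler_peMr // (le_trans ler01).
by rewrite mem_primes => /andP[/andP[pp _] _]; rewrite E_ge1 // ltr1n prime_gt1.
Qed.

Lemma prodE_composite m : (2 < m)%N -> ~~ prime m ->
  E m%:R + (2 * m%:R)^-1 <= prodE R m.
Proof.
move=> m2 mNp; have m1 : (1 < m)%N by exact: ltnW.
apply: le_trans (E_pdiv_le_prodE m1).
have p1 : (1 < pdiv m)%N by rewrite prime_gt1 // pdiv_prime.
have pm : (pdiv m ^ 2 <= m)%N.
  by rewrite leqNgt; apply: contra mNp; apply: ltn_pdiv2_prime; lia.
rewrite !E_sub1 ?ltr1n // -addrA lerD2l.
have p2 : (1 < pdiv m ^ 2)%N by rewrite -[1%N](exp1n 2) ltn_exp2r.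
apply: (@le_trans _ _ (m%:R - 1)^-1); last first.
  rewrite lef_pV2 ?posrE ?subr_gt0 -?natrX ?ltr1n // lerD2r ler_nat //.
have {}m2 : 3 <= m%:R :> R by rewrite (ler_nat _ 3).
have -> : (m%:R - 1)^-1 = (m%:R ^+ 2 - 1)^-1 + m%:R / (m%:R ^+ 2 - 1) :> R.
  field; rewrite !lt0r_neq0 //; nra.
rewrite lerD2l ler_pdivlMr; last by nra.
rewrite mulrC ler_pdivrMr; nra.
Qed.

Lemma E_le_prodE m : (2 < m)%N -> E m%:R <= prodE R m.
Proof.
move=> m2; have [/prodE_prime->//|mNp] := boolP (prime m).
by apply: le_trans (prodE_composite m2 mNp); rewrite lerDl invr_ge0 mulr_ge0.
Qed.

Lemma det_A n : \det (A R n) =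
  prodE R (2 * n + 1) * prodE R (2 * n + 3)
  - E (2 * n + 1)%:R * E (2 * n + 3)%:R.
Proof.
rewrite (expand_det_row _ ord0) !big_ord_recl big_ord0 /cofactor !det_mx11 !mxE /=.
by rewrite expr0 expr1; ring.
Qed.

Definition twin n := prime (2 * n + 1) && prime (2 * n + 3).

Lemma det_A_twin n : twin n -> \det (A R n) = 0.
Proof. by case/andP=> p q; rewrite det_A !prodE_prime // subrr. Qed.

Lemma det_A_ntwin n : (0 < n)%N -> ~~ twin n ->
  (10 * n%:R)^-1 <= \det (A R n).
Proof.
move=> n0 nT; rewrite det_A.
have m1 : (2 < 2 * n + 1)%N by lia.
have m3 : (2 < 2 * n + 3)%N by lia.
have := E_le_prodE m1; have := E_le_prodE m3.
have : 1 <= E (2 * n + 1)%:R :> R by apply: E_ge1; rewrite ltr1n; lia.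
have : 1 <= E (2 * n + 3)%:R :> R by apply: E_ge1; rewrite ltr1n; lia.
(* The constant 10 comes from 2(2n+3) = 4n+6 <= 10n, valid for n >= 1. *)
have le10 k : (0 < k <= 2 * n + 3)%N -> (10 * n%:R)^-1 <= (2 * k%:R)^-1 :> R.
  move=> /andP[k0 kn]; rewrite lef_pV2 ?posrE ?mulr_gt0 ?ltr0n //.
  by rewrite -!natrM ler_nat; lia.
have d0 : 0 < (10 * n%:R)^-1 :> R by rewrite invr_gt0 mulr_gt0 ?ltr0n.
have key : E (2 * n + 1)%:R + (10 * n%:R)^-1 <= prodE R (2 * n + 1) \/
    E (2 * n + 3)%:R + (10 * n%:R)^-1 <= prodE R (2 * n + 3).
  move: nT; rewrite /twin negb_and => /orP[] /prodE_composite h; [left|right].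
  - by apply: le_trans (h m1); rewrite lerD2l le10 //; lia.
  - by apply: le_trans (h m3); rewrite lerD2l le10 //; lia.
(* If one diagonal entry exceeds the [E] entry of its row by at least d, the determinant is at least
   d times the other [E] entry, which is at least 1. *)
case: key; nra.
Qed.

End Determinant.

(** * A uniform bound on the partial sums of n^(-(1+e)) *)

Section PowerSeries.
Variables (R : realType) (e : R).
Hypothesis e0 : 0 < e.

(* [n^-e / (n+1)^-e = expR (- e * ln (1 - 1/(n+1))) >= 1 + e/(n+1)]. *)
Lemma powR_telescope n : (0 < n)%N ->
  e * n.+1%:R `^ (- (1 + e)) <= n%:R `^ (- e) - n.+1%:R `^ (- e).
Proof.
move=> n0; have nR : 0 < n%:R :> R by rewrite ltr0n.
have nS : 0 < n.+1%:R :> R by rewrite ltr0n.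
have ratio : n%:R = n.+1%:R * (1 - n.+1%:R^-1) :> R.
  by rewrite mulrBr mulr1 divff ?lt0r_neq0 // -natr1 addrK.
have t0 : 0 < 1 - n.+1%:R^-1 :> R by rewrite subr_gt0 invf_lt1 // ltr1n.
rewrite {1}ratio powRM ?(ltW nS) ?(ltW t0) // opprD powRD; last first.
  by rewrite lt0r_neq0 // implybT.
rewrite powR_inv1 ?(ltW nS) //.
have x0 : 0 < n.+1%:R `^ (- e) by exact: powR_gt0.
rewrite -[X in _ <= _ - X]mulr1 -mulrBr mulrA mulrC ler_pM2l //.
rewrite lerBrDr addrC /powR gt_eqF //; apply: le_trans (expR_ge1Dx _).
rewrite lerD2l mulNr -mulrN ler_pM2l // lerNr; apply: le_ln1Dx.
by move: t0; rewrite subr_gt0 ltrN2.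
Qed.

Lemma psum_powR_le k : \sum_(1 <= n < k.+1) n%:R `^ (- (1 + e)) <= 1 + e^-1.
Proof.
case: k => [|k]; first by rewrite big_geq // addr_ge0 // invr_ge0 ltW.
(* The first term is 1 and the later ones telescope; keeping the remainder (k+1)^(-e) in the bound
   makes the induction go through. *)
suff : \sum_(1 <= n < k.+2) n%:R `^ (- (1 + e))
    <= 1 + e^-1 * (1 - k.+1%:R `^ (- e)).
  by move=> /le_trans -> //; rewrite lerD2l ler_piMr ?invr_ge0 ?(ltW e0) //.
elim: k => [|k IHk]; first by rewrite big_nat1 !powR1 subrr mulr0 addr0.
rewrite big_nat_recr //=; apply: le_trans (lerD IHk (lexx _)) _.
rewrite -addrA lerD2l -lerBrDl -mulrBr -ler_pdivrMl ?invr_gt0 // invrK.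
by apply: le_trans (powR_telescope (ltn0Sn k)) _; lra.
Qed.

End PowerSeries.

(** * Twin prime pairs and their indices n *)

Lemma twin_pairE : twin_prime_pairs =
  [set (2 * n + 1, 2 * n + 3)%N | n in [set n | twin n]].
Proof.
apply/seteqP; split=> [[p q]|_ [n /andP[p q] <-]] /=; last first.
  by split => //=; lia.
move=> [/= pp pq qE]; subst q.
(* The prime 2 starts no pair, since 4 is composite; hence p is odd, of the form 2n+1. *)
have [p2|podd] := even_prime pp; first by subst p.
exists p./2; last by congr pair; lia.
apply/andP; split; first by have -> : (2 * p./2 + 1 = p)%N by lia.
by have -> : (2 * p./2 + 3 = p + 2)%N by lia.
Qed.

Lemma card_twin : (twin_prime_pairs #= [set n | twin n])%card.
Proof. by rewrite twin_pairE; apply: inj_card_eq => m n _ _ [] /=; lia. Qed.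

(** Index 0 would require 1 to be prime, so a series starting at n = 1 misses no pair. *)
Lemma twin_gt0 n : twin n -> (0 < n)%N.
Proof. by case: n. Qed.

Lemma count_twin_near N : (twin_prime_pairs #= `I_N)%card ->
  \forall k \near \oo, count twin (iota 1 k) = N.
Proof.
rewrite (card_eql card_twin) => cN.
have finT : finite_set [set n | twin n] by apply/finite_setP; exists N.
(* From the largest twin index on, [iota 1 k], which runs from 1 to k, contains every twin index. *)
exists (\max_(n <- fset_set [set n | twin n]) n)%N => //= k /= le_k.
rewrite -(card_fset_set cN) -size_filter; apply/perm_size/uniq_perm.
- by rewrite filter_uniq // iota_uniq.
- exact: fset_uniq.
move=> n; rewrite mem_filter mem_iota in_fset_set //.
apply/idP/idP => [/andP[Tn _]|]; first exact: mem_set.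
move=> Tn; have Tn' : twin n := set_mem Tn.
rewrite Tn' twin_gt0 //= add1n ltnS; apply: leq_trans le_k.
by apply: (@leq_bigmax_seq _ _ xpredT id) => //; rewrite in_fset_set.
Qed.

Lemma finite_twin_near :
  (\forall k \near \oo, ~~ twin k) -> finite_set twin_prime_pairs.
Proof.
move=> [K _ noT]; rewrite (eq_finite_set card_twin).
apply: sub_finite_set (finite_II K) => n /= Tn.
by rewrite ltnNge; apply/negP => /noT; rewrite /= Tn.
Qed.

(** * Splitting the series into a twin count and a convergent rest *)

Section Series.
Variables (R : realType) (s : R).
Hypothesis s2 : 2 < s.

Lemma omega_term_twin n : twin n -> omega_term s n = 1.
Proof. by move=> Tn; rewrite /omega_term det_A_twin // mul0r addr0 divr1. Qed.

Definition rest_term n := if twin n then 0 else omega_term s n.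

Lemma omega_psumE k : omega_psum s k =
  (count twin (iota 1 k))%:R + \sum_(1 <= n < k.+1) rest_term n.
Proof.
rewrite /omega_psum /index_iota subn1 /= -sum1_count natr_sum.
rewrite [X in _ = X + _]big_mkcond -big_split.
apply: eq_bigr => n _ /=.
rewrite /rest_term; case: ifPn => [/omega_term_twin ->|_]; first by rewrite addr0.
by rewrite add0r.
Qed.

(** By [det_A_ntwin] the determinant times n^s is at least n^(s-1)/10. The exponent s-1 is written 1
    + (s-2) to match [psum_powR_le] with e = s-2. *)
Lemma rest_term_bound n : (0 < n)%N -> ~~ twin n ->
  0 < omega_term s n <= 10 * n%:R `^ (- (1 + (s - 2))).
Proof.
move=> n0 nT; have nR : 0 < n%:R :> R by rewrite ltr0n.
have d := det_A_ntwin R n0 nT.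
set x := n%:R `^ (1 + (s - 2)).
have x0 : 0 < x by exact: powR_gt0.
have ns : n%:R `^ s = n%:R * x.
  rewrite -[X in X * _](powRr1 (ltW nR)) -powRD ?lt0r_neq0 ?implybT //.
  by congr (_ `^ _); ring.
have le : x / 10 <= \det (A R n) * n%:R `^ s.
  rewrite ns; apply: le_trans (ler_wpM2r _ d); last by rewrite mulr_ge0 ?ltW.
  by rewrite le_eqVlt; apply/orP; left; apply/eqP; field; rewrite lt0r_neq0.
rewrite /omega_term powRN -/x div1r invr_gt0; apply/andP; split; first by nra.
rewrite -[10]invrK -invfM lef_pV2 ?posrE; nra.
Qed.

Lemma rest_term_ge0 n : (0 < n)%N -> 0 <= rest_term n.
Proof.
rewrite /rest_term; case: ifPn => // nT n0.
by case/andP: (rest_term_bound n0 nT) => /ltW.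
Qed.

Lemma rest_psum_nondecreasing :
  {homo (fun k => \sum_(1 <= n < k.+1) rest_term n) : k l / (k <= l)%N >-> k <= l}.
Proof.
move=> k l kl; rewrite [leRHS](big_cat_nat (n := k.+1)) //= lerDl.
rewrite big_nat_cond sumr_ge0 // => n /andP[/andP[kn _] _].
by rewrite rest_term_ge0 // (leq_trans _ kn).
Qed.

(** The partial sums are monotone and at most 10 (1 + 1/(s-2)), so [tau] below is a genuine limit
    for every s > 2. *)
Lemma rest_psum_cvg : cvgn (fun k => \sum_(1 <= n < k.+1) rest_term n).
Proof.
apply: nondecreasing_is_cvgn rest_psum_nondecreasing _.
have e0 : 0 < s - 2 by rewrite subr_gt0.
exists (10 * (1 + (s - 2)^-1)) => _ [k _ <-].
apply: le_trans (ler_wpM2l _ (psum_powR_le e0 k)); last by [].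
rewrite mulr_sumr; apply: ler_sum_nat => n /andP[n0 _].
rewrite /rest_term; case: ifPn => [_|nT]; first by rewrite mulr_ge0 // powR_ge0.
by case/andP: (rest_term_bound n0 nT).
Qed.

Definition tau := limn (fun k => \sum_(1 <= n < k.+1) rest_term n).

(* The pair (9, 11), i.e. n = 4, is not a twin prime pair. *)
Lemma tau_gt0 : 0 < tau.
Proof.
have n4 : ~~ twin 4 by [].
apply: lt_le_trans (nondecreasing_cvgn_le rest_psum_nondecreasing rest_psum_cvg 4).
rewrite big_nat_recr //= ltr_wpDl //.
  rewrite big_nat_cond sumr_ge0 // => n /andP[/andP[n0 _] _].
  exact: rest_term_ge0.
by rewrite /rest_term (negbTE n4); case/andP: (rest_term_bound (isT : 0 < 4)%N n4).
Qed.

Lemma omega_psum_cvg N : (twin_prime_pairs #= `I_N)%card ->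
  omega_psum s @ \oo --> N%:R + tau.
Proof.
move=> /count_twin_near cN.
have -> : omega_psum s = (fun k => (count twin (iota 1 k))%:R) +
    (fun k => \sum_(1 <= n < k.+1) rest_term n).
  by apply/funext => k; exact: omega_psumE.
apply: cvgD rest_psum_cvg.
by apply: cvg_near_cst; apply: filterS cN => k ->.
Qed.

(* The terms of a convergent series tend to 0, but twin primes give terms 1. *)
Lemma omega_psum_cvg_finite :
  cvgn (omega_psum s) -> finite_set twin_prime_pairs.
Proof.
move=> cv; apply: finite_twin_near.
have cvS : [sequence omega_psum s k.+1]_k @ \oo --> limn (omega_psum s).
  by rewrite cvg_shiftS.
have := cvgB cvS cv; rewrite subrr => lim0.
have [K _ lt1] := cvgr_dist_lt _ _ (lim0 _) _ ltr01.
(* The difference of partial sums at position k is the term of index k+1, so the threshold for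
   indices is K+1. *)
exists K.+1 => // -[|k] //= Kk; apply/negP => Tk.
have := lt1 k Kk; rewrite /= sub0r normrN fctE /omega_psum.
by rewrite big_nat_recr //= omega_term_twin // addrAC subrr add0r normr1 ltxx.
Qed.

End Series.

Theorem proposition3p1 (R : realType) (s : R) (hs : 2 < s) :
  exists tau : R,
    [/\ 0 < tau,
        cvg (omega_psum s @ \oo) <-> finite_set twin_prime_pairs
      & forall N : nat, (twin_prime_pairs #= `I_N)%card ->
          omega_psum s @ \oo --> N%:R + tau].
Proof.
exists (tau s); split; [exact: tau_gt0| |exact: omega_psum_cvg].
split; first exact: omega_psum_cvg_finite.
move=> /finite_setP[N cN]; apply/cvg_ex; exists (N%:R + tau s).
exact: omega_psum_cvg.
Qed.
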